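(* Let $A$ be a $d_1$-dimensional $k_1$-stochastic matrix of order $n$ and let $B$ be a $d_2$-dimensional $k_2$-stochastic matrix of order $n$. Put $r = \max\{d_1 + k_2, d_2 + k_1\}$. Then $n^{k_1 + k_2 - r}(A \times B)$ is a $(d_1+d_2)$-dimensional $r$-stochastic matrix, where $A\times B$ denotes the outer product.
   Context: Let $I_n^d = \{1,\ldots,n\}^d$ with $n,d$ positive integers. A $d$-dimensional matrix $A$ of order $n$ is an array $(a_\alpha)_{\alpha\in I_n^d}$ of real numbers. For $k\in\{0,\ldots,d\}$, a $k$-dimensional plane in $A$ is a submatrix obtained by fixing some $d-k$ components of the indices and letting the other $k$ components vary from $1$ to $n$. For $k\in\{0,\ldots,d\}$, $A$ is $k$-stochastic if all its entries are nonnegative and the sum of entries in each $k$-dimensional plane equals $1$. The outer product $A\times B$ of a $d_1$-dimensional matrix $A$ and a $d_2$-dimensional matrix $B$, both of order $n$, is the $(d_1+d_2)$-dimensional matrix $C$ of order $n$ with entries $c_{\alpha\beta}=a_\alpha b_\beta$ for $\alpha\in I_n^{d_1}$, $\beta\in I_n^{d_2}$, where $\alpha\beta$ is the concatenation of $\alpha$ and $\beta$. *)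

(* Defs.v *)
(* MathComp, with the real numbers taken as an arbitrary R : realType. *)
From mathcomp Require Import all_boot all_order all_algebra.
From mathcomp Require Import reals.

Set Implicit Arguments.
Unset Strict Implicit.
Unset Printing Implicit Defensive.

Import Order.TTheory GRing.Theory Num.Theory.
Local Open Scope ring_scope.

(* I_n^d, with both coordinates and values numbered from 0. *)
Definition multi_index (n d : nat) : finType := {ffun 'I_d -> 'I_n}.

Notation mdmatrix R n d := {ffun multi_index n d -> R}.

(* The positions of the plane in which the components in F are fixed to their
   values in b and the others vary; the values of b outside F are irrelevant. *)
Definition plane (n d : nat) (F : {set 'I_d}) (b : multi_index n d) :
    {set multi_index n d} :=
  [set a : multi_index n d | [forall i in F, a i == b i]].

(* Since k ranges over {0, ..., d}, k <= d is part of the notion; it also rules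
   out the truncation in d - k. *)
Definition kstochastic (R : realType) (n d k : nat) (A : mdmatrix R n d) : Prop :=
  [/\ (k <= d)%N,
      forall a : multi_index n d, 0 <= A a &
      forall (F : {set 'I_d}) (b : multi_index n d),
        #|F| = (d - k)%N -> \sum_(a in plane F b) A a = 1].

Definition mi_cat (n d1 d2 : nat) (a : multi_index n d1) (b : multi_index n d2) :
    multi_index n (d1 + d2) :=
  [ffun i : 'I_(d1 + d2) => match split i with inl j => a j | inr j => b j end].

Definition mi_left (n d1 d2 : nat) (c : multi_index n (d1 + d2)) :
    multi_index n d1 := [ffun i : 'I_d1 => c (lshift d2 i)].

Definition mi_right (n d1 d2 : nat) (c : multi_index n (d1 + d2)) :
    multi_index n d2 := [ffun i : 'I_d2 => c (rshift d1 i)].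

Definition outer (R : realType) (n d1 d2 : nat)
    (A : mdmatrix R n d1) (B : mdmatrix R n d2) : mdmatrix R n (d1 + d2) :=
  [ffun c : multi_index n (d1 + d2) => A (mi_left c) * B (mi_right c)].

Definition mdscale (R : realType) (n d : nat) (x : R) (A : mdmatrix R n d) :
    mdmatrix R n d := [ffun a : multi_index n d => x * A a].

(* Every multi-index is a concatenation, so outer_cat determines outer A B. *)
Lemma mi_catK (n d1 d2 : nat) (c : multi_index n (d1 + d2)) :
  mi_cat (mi_left c) (mi_right c) = c.
Proof.
apply/ffunP => i; rewrite ffunE.
by case: splitP => j ij; rewrite ffunE; congr (c _); apply: val_inj; rewrite /= ij.
Qed.

Lemma mi_cat_left (n d1 d2 : nat) (a : multi_index n d1) (b : multi_index n d2) :
  mi_left (mi_cat a b) = a.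
Proof. by apply/ffunP => i; rewrite !ffunE -[lshift _ _]/(unsplit (inl i)) unsplitK. Qed.

Lemma mi_cat_right (n d1 d2 : nat) (a : multi_index n d1) (b : multi_index n d2) :
  mi_right (mi_cat a b) = b.
Proof. by apply/ffunP => i; rewrite !ffunE -[rshift _ _]/(unsplit (inr i)) unsplitK. Qed.

Lemma outer_cat (R : realType) (n d1 d2 : nat)
    (A : mdmatrix R n d1) (B : mdmatrix R n d2)
    (a : multi_index n d1) (b : multi_index n d2) :
  outer A B (mi_cat a b) = A a * B b.
Proof. by rewrite ffunE mi_cat_left mi_cat_right. Qed.

(* Main.v *)
Require Import Defs.
From mathcomp Require Import all_boot all_order all_algebra.
From mathcomp Require Import reals zify.

(** Fixing the components in F of a multi-index of the outer product amounts to
    fixing independently those of F that fall among the first d1 components and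
    those that fall among the last d2; hence a plane of the product is a product
    of a plane of A and a plane of B, and its sum is the product of the two sums
    ([sum_outer_plane]).  Neither plane need have the dimension k1 or k2 of the
    hypotheses, but the choice of r makes both at least that large: the number
    of fixed components is d1 + d2 - r = min (d1 - k1, d2 - k2), so at most
    d1 - k1 of them are fixed in A and at most d2 - k2 in B.  In a k-stochastic
    matrix a plane of dimension k + m is a disjoint union of n ^ m planes of
    dimension k, so that it sums to n ^ m ([sum_large_plane]).  If the two
    planes have dimensions k1 + m1 and k2 + m2, then r = k1 + m1 + k2 + m2, and
    the sum n ^ (m1 + m2) = n ^ (r - k1 - k2) does not depend on how F is
    distributed between A and B; the scaling factor cancels it. *)

Set Implicit Arguments.
Unset Strict Implicit.
Unset Printing Implicit Defensive.

Import Order.TTheory GRing.Theory Num.Theory.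
Local Open Scope ring_scope.

Definition mi_set (n d : nat) (b : multi_index n d) (j : 'I_d) (v : 'I_n) :
    multi_index n d := [ffun i => if i == j then v else b i].

Lemma in_plane_setU1 (n d : nat) (F : {set 'I_d}) (b a : multi_index n d)
    (j : 'I_d) (v : 'I_n) :
  j \notin F ->
  (a \in plane (j |: F) (mi_set b j v)) = (a \in plane F b) && (a j == v).
Proof.
move=> jF; rewrite !inE; apply/forall_inP/andP => [H | [/forall_inP H /eqP ajv] i].
- split; last by have := H j (setU11 j F); rewrite ffunE eqxx.
  apply/forall_inP => i iF.
  have ij : i != j by apply: contraNneq jF => <-.
  by have := H i (setU1r j iF); rewrite ffunE (negPf ij).
- by rewrite !inE ffunE; case: (eqVneq i j) => [-> _ | _ /H //]; apply/eqP.
Qed.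

(** Induction on m: each choice of the value of a further fixed component j
    gives one of the n planes, of dimension one less, into which the plane
    splits. *)
Lemma sum_large_plane (R : realType) (n d k : nat) (A : mdmatrix R n d)
    (hA : kstochastic k A) (m : nat) (F : {set 'I_d}) (b : multi_index n d) :
  (#|F| + m = d - k)%N -> \sum_(a in plane F b) A a = n%:R ^+ m.
Proof.
have [_ _ sumA] := hA.
elim: m F b => [|m IHm] F b cardF; first by rewrite sumA // -cardF addn0.
have [j jF] : exists j, j \notin F.
  apply/existsP; rewrite -negb_forall; apply/negP => /forallP allF.
  have FT : F = setT by apply/setP => i; rewrite inE allF.
  by move: cardF; rewrite FT cardsT card_ord; lia.
rewrite (partition_big (fun a : multi_index n d => a j) xpredT) //=.
under eq_bigr => v _.
  under eq_bigl => a do rewrite -in_plane_setU1 //.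
  rewrite IHm; last by rewrite cardsU1 jF; lia.
  over.
by rewrite sumr_const card_ord exprS mulr_natl.
Qed.

Lemma in_plane_cat (n d1 d2 : nat) (F : {set 'I_(d1 + d2)})
    (b : multi_index n (d1 + d2)) (a1 : multi_index n d1) (a2 : multi_index n d2) :
  (mi_cat a1 a2 \in plane F b) =
  (a1 \in plane (lshift d2 @^-1: F) (mi_left b)) &&
  (a2 \in plane (@rshift d1 d2 @^-1: F) (mi_right b)).
Proof.
have catl i : mi_cat a1 a2 (lshift d2 i) = a1 i.
  by rewrite -[in RHS](mi_cat_left a1 a2) [RHS]ffunE.
have catr i : mi_cat a1 a2 (rshift d1 i) = a2 i.
  by rewrite -[in RHS](mi_cat_right a1 a2) [RHS]ffunE.
rewrite !inE; apply/forall_inP/andP => [H | [/forall_inP H1 /forall_inP H2] i].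
- split; apply/forall_inP => i; rewrite inE => /H.
  + by rewrite catl [mi_left _ _]ffunE.
  + by rewrite catr [mi_right _ _]ffunE.
- case: (split_ordP i) => j -> jF.
  + by have := H1 j; rewrite inE [mi_left _ _]ffunE catl; apply.
  + by have := H2 j; rewrite inE [mi_right _ _]ffunE catr; apply.
Qed.

Lemma sum_outer_plane (R : realType) (n d1 d2 : nat)
    (A : mdmatrix R n d1) (B : mdmatrix R n d2)
    (F : {set 'I_(d1 + d2)}) (b : multi_index n (d1 + d2)) :
  \sum_(c in plane F b) outer A B c =
  (\sum_(a in plane (lshift d2 @^-1: F) (mi_left b)) A a) *
  (\sum_(a in plane (@rshift d1 d2 @^-1: F) (mi_right b)) B a).
Proof.
rewrite big_distrlr pair_big /=.
rewrite (reindex (fun p : multi_index n d1 * multi_index n d2 => mi_cat p.1 p.2)) /=.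
  by apply: eq_big => [p | p _]; rewrite ?in_plane_cat ?outer_cat.
exists (fun c => (mi_left c, mi_right c)) => [[a1 a2] _ | c _] /=.
- by rewrite mi_cat_left mi_cat_right.
- exact: mi_catK.
Qed.

Lemma card_split_ord (d1 d2 : nat) (F : {set 'I_(d1 + d2)}) :
  (#|lshift d2 @^-1: F| + #|@rshift d1 d2 @^-1: F| = #|F|)%N.
Proof.
rewrite -!sum1_card big_split_ord /=.
by congr (_ + _)%N; apply: eq_bigl => i; rewrite inE.
Qed.

Theorem theorem1 (R : realType) (n d1 d2 k1 k2 : nat)
    (hn : (0 < n)%N) (hd1 : (0 < d1)%N) (hd2 : (0 < d2)%N)
    (A : mdmatrix R n d1) (B : mdmatrix R n d2)
    (hA : kstochastic k1 A) (hB : kstochastic k2 B) :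
  let r := maxn (d1 + k2) (d2 + k1) in
  kstochastic r (mdscale (n%:R ^ (k1%:Z + k2%:Z - r%:Z)) (outer A B)).
Proof.
move=> r; have [k1d A0 _] := hA; have [k2d B0 _] := hB.
have r_le : (r <= d1 + d2)%N by lia.
split=> // [c | F b cardF].
  by rewrite !ffunE !mulr_ge0 // exprz_ge0.
under eq_bigr do rewrite ffunE.
rewrite -mulr_sumr sum_outer_plane.
have cardF12 := card_split_ord F.
set F1 := lshift d2 @^-1: F in cardF12 *.
set F2 := @rshift d1 d2 @^-1: F in cardF12 *.
have F1_le : (#|F1| <= d1 - k1)%N by lia.
have F2_le : (#|F2| <= d2 - k2)%N by lia.
rewrite (sum_large_plane hA (mi_left b) (subnKC F1_le)).
rewrite (sum_large_plane hB (mi_right b) (subnKC F2_le)).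
set m1 := (d1 - k1 - _)%N; set m2 := (d2 - k2 - _)%N.
have rE : r = (k1 + k2 + (m1 + m2))%N by lia.
have n_neq0 : n%:R != 0 :> R by rewrite pnatr_eq0 -lt0n.
by rewrite rE PoszD opprD addrA subrr add0r -exprD -exprnN mulVf ?expf_neq0.
Qed.
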